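(* The shift graph $G_{9,2}$ does not have the AOP property.
   Context: The shift graph $G_{n,2}$ has as vertices all pairs $(a_1,a_2)$ of integers with $1\leq a_1<a_2\leq n$; two vertices $(a_1,a_2)$ and $(b_1,b_2)$ are adjacent iff $a_2=b_1$ or $b_2=a_1$. An orientation of a simple undirected graph $G$ assigns exactly one direction to each edge; it is acyclic if it has no directed cycle. A graph $G$ has the AOP (acyclic one path) property if it has an acyclic orientation such that there is at most one directed path between any two vertices, i.e. for all distinct vertices $u,v$ there is at most one directed path from $u$ to $v$. *)

(* Defs.v *)
From mathcomp Require Import all_boot.

Set Implicit Arguments.
Unset Strict Implicit.
Unset Printing Implicit Defensive.

Record sgraph := SGraph {
  vertex :> finType;
  adj : rel vertex;
  adj_sym : symmetric adj;
  adj_irrefl : irreflexive adj }.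

(* [o x y] means that the edge xy is directed from x to y. *)
Definition orientation (G : sgraph) (o : rel G) : Prop :=
  (forall x y, o x y -> adj x y) /\
  (forall x y, adj x y -> o x y (+) o y x).

(* The nonempty sequence c lists the distinct vertices of a directed cycle. *)
Definition acyclic (T : finType) (o : rel T) : Prop :=
  forall c : seq T, c != [::] -> ~ ucycle o c.

(* The vertex sequence of the path is u :: p. *)
Definition dipath (T : finType) (o : rel T) (u v : T) (p : seq T) : bool :=
  [&& path o u p, last u p == v & uniq (u :: p)].

Definition AOP (G : sgraph) : Prop :=
  exists o : rel G,
    [/\ orientation o, acyclic o &
        forall u v : G, u != v ->
          forall p q : seq G, dipath o u v p -> dipath o u v q -> p = q].

(* Pairs (a1, a2) with 1 <= a1 < a2 <= n; 'I_n.+1 is {0, ..., n}. *)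
Definition shift_vertex (n : nat) : finType :=
  {a : 'I_n.+1 * 'I_n.+1 | (1 <= a.1) && (a.1 < a.2)}.

Definition shift_adj (n : nat) : rel (shift_vertex n) :=
  fun a b => ((val a).2 == (val b).1) || ((val b).2 == (val a).1).

Lemma shift_adj_sym n : symmetric (@shift_adj n).
Proof. by move=> a b; rewrite /shift_adj orbC. Qed.

Lemma shift_adj_irrefl n : irreflexive (@shift_adj n).
Proof.
move=> a; rewrite /shift_adj orbb; apply/negbTE.
by case/andP: (valP a) => _; apply: contraTneq => ->; rewrite ltnn.
Qed.

Definition shift_graph (n : nat) : sgraph :=
  SGraph (@shift_adj_sym n) (@shift_adj_irrefl n).

(* Main.v *)
(* The pairs with last entry b and those with first entry b span a complete
   bipartite graph K_{b-1,n-b}. In an AOP orientation every 4-cycle alternates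
   between sources and sinks, so for 2 < b < n-1 all edges through b have the
   same direction, forward ((a,b) to (b,c)) or backward. For n = 9 this gives
   five two-valued indices 3, ..., 7, so three of them, b < c < d, agree. Then
   (1,b), (b,c), (c,d), (d,9) and (1,b), (b,d), (d,9) are, up to reversal, two
   directed paths with the same ends. *)
Require Import Defs.
From mathcomp Require Import all_boot.
From mathcomp Require Import zify.

Set Implicit Arguments.
Unset Strict Implicit.
Unset Printing Implicit Defensive.

Definition AOP_orientation (G : sgraph) (o : rel G) : Prop :=
  [/\ orientation o, acyclic o &
      forall u v : G, u != v ->
        forall p q : seq G, dipath o u v p -> dipath o u v q -> p = q].

Section Orientation.
Variables (G : sgraph) (o : rel G).
Hypothesis oG : AOP_orientation o.

Lemma AOP_orientN x y : adj x y -> o y x = ~~ o x y.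
Proof. by case: oG => -[_ o_adj] _ _ /o_adj; case: (o x y); case: (o y x). Qed.

(** The other two edges of the 4-cycle have four possible orientations. One closes a directed cycle;
    two give a path of length 3 parallel to a single edge; the last gives two paths of length 2 from
    [x] to [x']. *)
Lemma AOP_C4_no_dipath2 x y x' y' :
    adj x y -> adj y x' -> adj x' y' -> adj y' x -> x != x' -> y != y' ->
  o x y -> o y x' -> False.
Proof.
move=> xy yx' x'y' y'x Nxx' Nyy' oxy oyx'.
have neq (u v : G) : adj u v -> u != v.
  by apply: contraTneq => ->; rewrite adj_irrefl.
have sym (u v : G) : u != v -> ((u == v) = false) * ((v == u) = false).
  by move=> /negPf uv; rewrite [v == u]eq_sym uv.
have N := (sym _ _ (neq _ _ xy), sym _ _ (neq _ _ yx'), sym _ _ (neq _ _ x'y'),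
           sym _ _ (neq _ _ y'x), sym _ _ Nxx', sym _ _ Nyy').
case: oG => _ acyc onep.
have := AOP_orientN x'y'; have := AOP_orientN y'x.
case ox'y': (o x' y'); case oy'x: (o y' x) => /= oxy' oy'x'.
- apply: (acyc [:: x; y; x'; y']) => //.
  by rewrite /ucycle /= !inE oxy oyx' ox'y' oy'x !N.
- have := onep x y' _ [:: y; x'; y'] [:: y'].
  rewrite /dipath /= !inE oxy oyx' ox'y' oxy' !N !eqxx.
  by move=> /(_ isT isT isT).
- have := onep y' x' _ [:: x; y; x'] [:: x'].
  rewrite /dipath /= !inE oxy oyx' oy'x oy'x' !N !eqxx.
  by move=> /(_ isT isT isT).
- have := onep x x' _ [:: y; x'] [:: y'; x'].
  rewrite /dipath /= !inE oxy oyx' oxy' oy'x' !N !eqxx.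
  by move=> /(_ isT isT isT) [/eqP]; rewrite (negPf Nyy').
Qed.

(** Otherwise [y] would be the middle of a directed path of length 2, from [x] to [x'] or back. *)
Lemma AOP_C4_alternating x y x' y' :
    adj x y -> adj y x' -> adj x' y' -> adj y' x -> x != x' -> y != y' ->
  o x y = o x' y.
Proof.
move=> xy yx' x'y' y'x Nxx' Nyy'; have ox'y := AOP_orientN yx'.
have oyx := AOP_orientN xy.
case oxy: (o x y) oyx => oyx; case oyx': (o y x') ox'y => // ox'y; exfalso.
  exact: (AOP_C4_no_dipath2 xy yx' x'y' y'x).
by apply: (@AOP_C4_no_dipath2 x' y x y'); rewrite // 1?adj_sym // eq_sym.
Qed.

End Orientation.

Section ShiftGraph.
Variable n : nat.

Notation arc a b := ((0 < a < b) && (b <= n)).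

Lemma arc_ltl a b : arc a b -> a < n.+1. Proof. lia. Qed.

Lemma arc_ltr a b : arc a b -> b < n.+1. Proof. lia. Qed.

Lemma arc_lt a b : arc a b -> 0 < a < b. Proof. lia. Qed.

Definition shift_pair (a b : nat) (ab : arc a b) : shift_graph n :=
  exist _ (Ordinal (arc_ltl ab), Ordinal (arc_ltr ab)) (arc_lt ab).

Lemma shift_pair_eq a b c d (ab : arc a b) (cd : arc c d) :
  (shift_pair ab == shift_pair cd) = (a == c) && (b == d).
Proof. by rewrite -val_eqE /shift_pair. Qed.

Lemma shift_pair_adj a b c (ab : arc a b) (bc : arc b c) :
  adj (shift_pair ab) (shift_pair bc).
Proof. by apply/orP; left; rewrite -val_eqE /=. Qed.

Variable o : rel (shift_graph n).
Hypothesis oG : AOP_orientation o.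

Lemma shift_direction_left b a a' c (ab : arc a b)
    (a'b : arc a' b) (bc : arc b c) :
    b < n.-1 ->
  o (shift_pair ab) (shift_pair bc) = o (shift_pair a'b) (shift_pair bc).
Proof.
move=> b_lt; have [eq_a | Naa'] := eqVneq a a'.
  by subst a'; rewrite (bool_irrelevance ab a'b).
(* Since [b < n.-1], both [n.-1] and [n] exceed [b], so a second right neighbour completes a
   4-cycle. *)
have [c' bc' Ncc'] : exists2 c', arc b c' & c != c'.
  have [->|] := eqVneq c n; first by exists n.-1; lia.
  by exists n; lia.
apply: (AOP_C4_alternating oG (y' := shift_pair bc')).
- exact: shift_pair_adj.
- by rewrite adj_sym shift_pair_adj.
- exact: shift_pair_adj.
- by rewrite adj_sym shift_pair_adj.
- by rewrite shift_pair_eq (negPf Naa').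
- by rewrite shift_pair_eq (negPf Ncc') andbF.
Qed.

Lemma shift_direction_right b a c c' (ab : arc a b)
    (bc : arc b c) (bc' : arc b c') :
    2 < b ->
  o (shift_pair ab) (shift_pair bc) = o (shift_pair ab) (shift_pair bc').
Proof.
move=> b_gt; have [eq_c | Ncc'] := eqVneq c c'.
  by subst c'; rewrite (bool_irrelevance bc bc').
have [a' a'b Naa'] : exists2 a', arc a' b & a != a'.
  have [->|] := eqVneq a 1; first by exists 2; lia.
  by exists 1; lia.
(* The 4-cycle lemma compares edges directed into the shared vertex, here [(a,b)], so both edges are
   reversed first. *)
apply/esym/negb_inj.
rewrite -!(AOP_orientN oG) ?shift_pair_adj //; apply/esym.
apply: (AOP_C4_alternating oG (y' := shift_pair a'b)).
- by rewrite adj_sym shift_pair_adj.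
- exact: shift_pair_adj.
- by rewrite adj_sym shift_pair_adj.
- exact: shift_pair_adj.
- by rewrite shift_pair_eq (negPf Ncc') andbF.
- by rewrite shift_pair_eq (negPf Naa').
Qed.

(** Here [f] is [true] for forward and [false] for backward. *)
Definition directed_through (b : nat) (f : bool) : Prop :=
  forall a c (ab : arc a b) (bc : arc b c),
    o (shift_pair ab) (shift_pair bc) = f.

Lemma exists_directed_through b : 2 < b < n.-1 ->
  exists f : bool, directed_through b f.
Proof.
move=> /andP[b_gt b_lt]; have b1 : arc 1 b by lia.
have bn : arc b n by lia.
(* The edge from [(1,b)] to [(b,n)] serves as reference: the left end is exchanged first, then the
   right end. *)
exists (o (shift_pair b1) (shift_pair bn)) => a c ab bc.
by rewrite (shift_direction_left ab b1) // (shift_direction_right _ bc bn).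
Qed.

Lemma no_three_directed_through b c d f : 1 < b -> b < c < d -> d < n ->
    directed_through b f -> directed_through c f -> directed_through d f ->
  False.
Proof.
move=> b_gt bcd d_lt fb fc fd.
have H1b : arc 1 b by lia.
have Hbc : arc b c by lia.
have Hbd : arc b d by lia.
have Hcd : arc c d by lia.
have Hdn : arc d n by lia.
have bwd i j k (ij : arc i j) (jk : arc j k) :
    o (shift_pair jk) (shift_pair ij) = ~~ o (shift_pair ij) (shift_pair jk).
  by rewrite (AOP_orientN oG) ?shift_pair_adj.
case: (oG) => _ _ onep.
case: f fb fc fd => fb fc fd.
- have := onep (shift_pair H1b) (shift_pair Hdn) _
    [:: shift_pair Hbc; shift_pair Hcd; shift_pair Hdn]
    [:: shift_pair Hbd; shift_pair Hdn].
  rewrite /dipath /= !(fb, fc, fd) !eqxx !inE !shift_pair_eq => onep2.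
  (* Only distinctness of vertices remains to be checked; the two paths differ in length, so they
     cannot be equal. *)
  by have // := onep2 ltac:(lia) ltac:(lia) ltac:(lia).
- have := onep (shift_pair Hdn) (shift_pair H1b) _
    [:: shift_pair Hcd; shift_pair Hbc; shift_pair H1b]
    [:: shift_pair Hbd; shift_pair H1b].
  rewrite /dipath /= !bwd !(fb, fc, fd) !eqxx !inE !shift_pair_eq => onep2.
  by have // := onep2 ltac:(lia) ltac:(lia) ltac:(lia).
Qed.

End ShiftGraph.

Theorem theorem18 : ~ AOP (shift_graph 9).
Proof.
case=> o oG.
have dir b (b_bd : 2 < b < 9.-1) := exists_directed_through oG b_bd.
have [f3 d3] := dir 3 isT; have [f4 d4] := dir 4 isT.
have [f5 d5] := dir 5 isT; have [f6 d6] := dir 6 isT.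
have [f7 d7] := dir 7 isT.
(* Pigeonhole in each of the 32 cases: the match backtracks until three indices with equal direction
   come in increasing order. *)
case: f3 d3 => d3; case: f4 d4 => d4; case: f5 d5 => d5;
  case: f6 d6 => d6; case: f7 d7 => d7;
  match goal with
  | db : directed_through o ?b ?f, dc : directed_through o ?c ?f,
    dd : directed_through o ?d ?f |- _ =>
      exact (no_three_directed_through oG
               (isT : 1 < b) (isT : b < c < d) (isT : d < 9) db dc dd)
  end.
Qed.
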